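(* Let $\alpha_i,\beta_i,\gamma_i$ ($1\le i\le n-1$) be complex numbers and put $\beta_0=1$. For any $t_1,\dots,t_{n-1}$, let $\tilde M_Q(t_1,\dots,t_{n-1})$ be the $n\times n$ unit upper triangular matrix with $(j,j+1)$ entry $t_j$ for $j=1,\dots,n-1$ and with $(j+1,k+1)$ entry $$a_{jk}=-\beta_j\cdot(\alpha-\beta\gamma)^{\times}_{j,k}\cdot\gamma_k,\qquad(\alpha-\beta\gamma)^{\times}_{j,k}=\prod_{i=j+1}^{k-1}(\alpha_i-\beta_i\gamma_i),$$ for $0\le j$, $j+2\le k\le n-1$. Then $\tilde M_Q(t_1,\dots,t_{n-1})$ is upper triangular $2$-quasiseparable with generators $$d_j=1\ (j=1,\dots,n),\qquad g_j=[\,t_j\;\;-\beta_{j-1}\,]\ (j=1,\dots,n-1),$$ $$b_i=\begin{bmatrix}0&0\\ \gamma_i(\alpha_{i-1}-\beta_{i-1}\gamma_{i-1})&\alpha_{i-1}-\beta_{i-1}\gamma_{i-1}\end{bmatrix}\ (i=2,\dots,n-1),\qquad h_k=[\,1\;\;0\,]^T\ (k=2,\dots,n).$$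
   Context: An $n\times n$ matrix $A$ is called upper triangular $2$-quasiseparable with generators $d_j\in\mathbb{C}$, $g_j\in\mathbb{C}^{1\times2}$, $b_i\in\mathbb{C}^{2\times2}$, $h_k\in\mathbb{C}^{2\times1}$ if $A_{jk}=0$ for $k<j$, $A_{jj}=d_j$, $A_{j,j+1}=g_jh_{j+1}$, and $A_{jk}=g_jb_{j+1}b_{j+2}\cdots b_{k-1}h_k$ for $k>j+1$. *)

(* Defs.v *)
From mathcomp Require Import all_boot all_order all_algebra.
From mathcomp Require Import reals.
From mathcomp Require Import complex.

Set Implicit Arguments.
Unset Strict Implicit.
Unset Printing Implicit Defensive.

Import GRing.Theory.

Local Open Scope ring_scope.

(* All families of scalars and generators keep their 1-based indexing: they are
   functions on [nat] of which only the values in the relevant range matter.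
   Matrix indices are 0-based, so the ordinals [j k : 'I_n] stand for the
   (j+1, k+1) entry. *)

Definition upper_quasiseparable2 (F : fieldType) (n : nat) (A : 'M[F]_n)
    (d : nat -> F) (g : nat -> 'rV[F]_2)
    (b : nat -> 'M[F]_2) (h : nat -> 'cV[F]_2) : Prop :=
  [/\ forall j k : 'I_n, (k < j)%N -> A j k = 0,
      forall j : 'I_n, A j j = d j.+1,
      forall j k : 'I_n, k = j.+1 :> nat -> A j k = (g j.+1 *m h k.+1) 0 0
    & forall j k : 'I_n, (j.+1 < k)%N ->
        A j k = (g j.+1 *m (\prod_(j.+2 <= i < k.+1) b i) *m h k.+1) 0 0].

Definition quasi_prod (F : fieldType) (alpha beta gamma : nat -> F)
    (j k : nat) : F :=
  \prod_(j.+1 <= i < k) (alpha i - beta i * gamma i).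

Definition quasi_coef (F : fieldType) (alpha beta gamma : nat -> F)
    (j k : nat) : F :=
  - beta j * quasi_prod alpha beta gamma j k * gamma k.

(* The coefficient a_{jk} sits at position (j+1, k+1), hence at the 0-based
   position (j, k), while t_j sits at (j, j+1), hence at the 0-based position
   (j-1, j). *)
Definition MtildeQ (F : fieldType) (n : nat) (alpha beta gamma t : nat -> F) :
    'M[F]_n :=
  \matrix_(j < n, k < n)
    if (k < j)%N then 0
    else if k == j then 1
    else if k == j.+1 :> nat then t j.+1
    else quasi_coef alpha beta gamma j k.

Definition gen_d (F : fieldType) (j : nat) : F := 1.

Definition gen_g (F : fieldType) (beta t : nat -> F) (j : nat) : 'rV[F]_2 :=
  row_mx (t j)%:M (- beta j.-1)%:M.

Definition gen_b (F : fieldType) (alpha beta gamma : nat -> F) (i : nat) :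
    'M[F]_2 :=
  let delta := alpha i.-1 - beta i.-1 * gamma i.-1 in
  block_mx (0 : 'M[F]_1) (0 : 'M[F]_1)
           (gamma i * delta)%:M delta%:M.

Definition gen_h (F : fieldType) (k : nat) : 'cV[F]_2 :=
  col_mx (1%:M : 'M[F]_1) (0 : 'M[F]_1).

(* Main.v *)
Require Import Defs.
From mathcomp Require Import all_boot all_order all_algebra.
From mathcomp Require Import reals.
From mathcomp Require Import complex.

(** Let [e] be the second basis column.  Each [b_i] has a zero first row, so it
    sends every column to a multiple of [e]: with
    [delta_i = alpha_(i-1) - beta_(i-1) gamma_(i-1)], we have
    [b_i h = gamma_i delta_i e] and [b_i e = delta_i e].  In the product
    [g_(j+1) b_(j+2) ... b_k h_(k+1)], read from the right, the factor [b_k]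
    thus turns [h] into [gamma_k delta_k e], the other factors only contribute
    their eigenvalues [delta_i], and [g_(j+1)] finally picks out its second
    coordinate [- beta_j].  As [delta_i] carries the index [i - 1], the
    eigenvalues for [j + 2 <= i <= k] multiply to the product of
    [alpha_i - beta_i gamma_i] over [j + 1 <= i <= k - 1], which gives
    [a_(j,k)]. *)

Local Open Scope ring_scope.
Local Open Scope complex_scope.

Import GRing.Theory.

Lemma prodmx_eigenvector (F : fieldType) (p : nat) (B : nat -> 'M[F]_p.+1)
    (c : nat -> F) (v : 'cV[F]_p.+1) (m n : nat) :
    (forall i, B i *m v = c i *: v) ->
  (\prod_(m <= i < n) B i) *m v = (\prod_(m <= i < n) c i) *: v.
Proof.
move=> Bv; elim/big_rec2: _ => [|i x M _ IH].
  by rewrite mul1mx scale1r.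
by rewrite -mulmxE -mulmxA IH -scalemxAr Bv scalerA mulrC.
Qed.

Section QuasiseparableGenerators.

Variables (F : fieldType) (alpha beta gamma t : nat -> F).

Let e : 'cV[F]_2 := col_mx (0 : 'M[F]_1) (1%:M : 'M[F]_1).
Let delta (i : nat) : F := alpha i.-1 - beta i.-1 * gamma i.-1.

Lemma mul_gen_b_e i : gen_b alpha beta gamma i *m e = delta i *: e.
Proof.
rewrite /gen_b /e (@mul_block_col _ 1 1 1 1) !mulmx1 !mulmx0 !add0r.
by rewrite (@scale_col_mx _ 1 1 1) scaler0 scalemx1.
Qed.

Lemma mul_gen_b_h i k :
  gen_b alpha beta gamma i *m gen_h F k = (gamma i * delta i) *: e.
Proof.
rewrite /gen_b /gen_h /e (@mul_block_col _ 1 1 1 1) !mulmx1 !mulmx0 !addr0.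
by rewrite (@scale_col_mx _ 1 1 1) scaler0 scalemx1.
Qed.

Lemma mul_gen_g_e j : (gen_g beta t j *m e) 0 0 = - beta j.-1.
Proof.
by rewrite /gen_g /e (@mul_row_col _ 1 1 1) mulmx0 mulmx1 add0r mxE.
Qed.

Lemma mul_gen_g_h j k : (gen_g beta t j *m gen_h F k) 0 0 = t j.
Proof.
by rewrite /gen_g /gen_h (@mul_row_col _ 1 1 1) mulmx0 mulmx1 addr0 mxE.
Qed.

Lemma mul_gen_g_prod_b_h (j k l : nat) : (j.+1 < k)%N ->
  (gen_g beta t j.+1 *m (\prod_(j.+2 <= i < k.+1) gen_b alpha beta gamma i)
     *m gen_h F l) 0 0 = quasi_coef alpha beta gamma j k.
Proof.
move=> ltjk; rewrite big_nat_recr //= -mulmxE -!mulmxA mul_gen_b_h.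
rewrite -scalemxAr (prodmx_eigenvector _ _ _ _ _ _ _ mul_gen_b_e).
rewrite scalerA -scalemxAr mxE mul_gen_g_e /quasi_coef.
(* Put the eigenvalue [delta k] back into the product and shift its index. *)
have -> : quasi_prod alpha beta gamma j k =
    (\prod_(j.+2 <= i < k) delta i) * delta k.
  by rewrite -big_nat_recr //= big_add1.
by rewrite mulrC [gamma k * _ * _]mulrC [gamma k * _]mulrC !mulrA.
Qed.

End QuasiseparableGenerators.

Theorem corollary3p4 (R : realType) (n : nat)
    (alpha beta gamma : nat -> R[i]) (hbeta0 : beta 0%N = 1)
    (t : nat -> R[i]) :
  upper_quasiseparable2 (MtildeQ n alpha beta gamma t)
    (@gen_d R[i]) (gen_g beta t) (gen_b alpha beta gamma) (@gen_h R[i]).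
Proof.
split=> [j k ltkj | j | j k kE | j k ltjk]; rewrite mxE.
- by rewrite ltkj.
- by rewrite ltnn eqxx.
- by rewrite mul_gen_g_h -val_eqE /= kE ltnNge leqnSn eqxx gtn_eqF.
- rewrite mul_gen_g_prod_b_h // -val_eqE /= ltnNge (ltnW (ltnW ltjk)) /=.
  by rewrite !gtn_eqF // ltnW.
Qed.
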